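(* Let $G$ be a (finite, simple) graph with $mad(G)<3$. Then $ch_3^d(G)\le 8$.
   Context: For a graph $G$ and an integer $r\ge 1$, an $r$-dynamic coloring of $G$ is a proper vertex coloring $\phi$ such that for every vertex $v$, the neighborhood $N_G(v)$ contains at least $\min\{r,\deg_G(v)\}$ distinct colors. Given a list assignment $L$, $G$ is $r$-dynamically $L$-colorable if it has an $r$-dynamic coloring $\phi$ with $\phi(v)\in L(v)$ for all $v$. The list $r$-dynamic chromatic number $ch_r^d(G)$ is the least $k$ such that $G$ is $r$-dynamically $L$-colorable for every list assignment $L$ with $|L(v)|\ge k$ for all $v$. The maximum average degree $mad(G)$ is the maximum of $2|E(H)|/|V(H)|$ over all subgraphs $H$ of $G$ with at least one vertex. *)

(* Defs.v *)
From mathcomp Require Import all_boot all_order all_algebra.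
From mathcomp Require Import finmap boolp.

Set Implicit Arguments.
Unset Strict Implicit.
Unset Printing Implicit Defensive.

Import Order.TTheory GRing.Theory Num.Theory.

Record sgraph := SGraph {
  vertex :> finType;
  adj : rel vertex;
  adj_sym : symmetric adj;
  adj_irrefl : irreflexive adj }.

Section Graph.
Variable G : sgraph.

Definition nbh (v : G) : {set G} := [set u | adj v u].

Definition deg (v : G) : nat := #|nbh v|.

Definition edges : {set {set G}} :=
  [set [set x; y] | x in G, y in nbh x].

(* Subgraphs are not assumed induced: (A, F) has vertex set A and edge set F. *)
Definition is_subgraph (H : {set G} * {set {set G}}) : bool :=
  (H.2 \subset edges) && [forall e in H.2, e \subset H.1].

(* The default value 0 only matters for the graph without vertices: the ratios
   are all nonnegative. *)
Definition mad : rat :=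
  (\big[Num.max/0]_(H : {set G} * {set {set G}}
                      | is_subgraph H && (H.1 != set0))
     (2 * #|H.2|%:R / #|H.1|%:R))%R.

Section Coloring.
Variable C : choiceType.

Definition proper_coloring (phi : G -> C) : Prop :=
  forall u v : G, adj u v -> phi u <> phi v.

Definition dynamic_coloring (r : nat) (phi : G -> C) : Prop :=
  proper_coloring phi /\
  forall v : G, minn r (deg v) <= #|` [fset phi u | u in nbh v]%fset|.

Definition dynamically_list_colorable (r : nat) (L : G -> {fset C}) : Prop :=
  exists phi : G -> C,
    dynamic_coloring r phi /\ forall v : G, phi v \in L v.

End Coloring.

Definition dynamically_choosable (r k : nat) : Prop :=
  forall (C : choiceType) (L : G -> {fset C}),
    (forall v : G, k <= #|` L v|) -> dynamically_list_colorable r L.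

Lemma inj_dynamic_coloring (C : choiceType) (r : nat) (phi : G -> C) :
  injective phi -> dynamic_coloring r phi.
Proof.
move=> phi_inj; split=> [u v uv /phi_inj euv|v].
  by move: uv; rewrite euv adj_irrefl.
by rewrite card_imfset //= -cardE geq_minr.
Qed.

Lemma inj_list_choice (C : choiceType) (L : G -> {fset C}) (s : seq G) :
  (forall v, #|G| <= #|` L v|) -> uniq s ->
  exists phi : G -> C, {in s &, injective phi} /\ forall v, phi v \in L v.
Proof.
move=> cardL; elim: s => [_|x s IHs /= /andP[xNs s_uniq]].
  have nonempty v : exists c, c \in L v.
    have : 0 < #|` L v| by apply: leq_trans (cardL v); apply/card_gt0P; exists v.
    by rewrite cardfs_gt0 => /fset0Pn.
  by exists (fun v => xchoose (nonempty v)); split=> // v; exact: xchooseP.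
have [phi [phi_inj phiL]] := IHs s_uniq.
pose used := [fset d in map phi s]%fset.
have [c cLx cNused] : exists2 c, c \in L x & c \notin used.
  have : ~~ (L x `<=` used)%fset.
    apply/negP => /fsubset_leq_card; apply/negP; rewrite -ltnNge.
    apply: (leq_trans _ (cardL x)); apply: (@leq_ltn_trans (size s)).
      by rewrite card_fseq -(size_map phi); exact: size_undup.
    have xs_uniq : uniq (x :: s) by rewrite /= xNs.
    by have := card_uniqP xs_uniq => /= <-; exact: max_card.
  by case/fsubsetPn => c; exists c.
exists (fun v => if v == x then c else phi v); split=> [u v|v]; last first.
  by case: eqP => [->|].
have used_s w : w \in s -> c <> phi w.
  by move=> ws ecw; case/negP: cNused; rewrite ecw inE /= map_f.
rewrite !inE; case: eqP => [->|_]; case: eqP => [->|_] //=.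
- by move=> _ vs /used_s; case.
- by move=> us _ /esym/used_s; case.
- exact: phi_inj.
Qed.

Lemma ex_dynamically_choosable (r : nat) :
  exists k, `[< dynamically_choosable r k >].
Proof.
exists #|G|; apply/asboolP => C L cardL.
have [phi [phi_inj phiL]] := inj_list_choice cardL (enum_uniq G).
exists phi; split=> //; apply: inj_dynamic_coloring => u v.
by apply: phi_inj; rewrite mem_enum.
Qed.

(* asbool makes the choosability predicate boolean, as ex_minn requires. *)
Definition list_dynamic_chromatic_number (r : nat) : nat :=
  ex_minn (ex_dynamically_choosable r).

End Graph.

(* Main.v *)
Require Import Defs.
From mathcomp Require Import all_boot all_order all_algebra.
From mathcomp Require Import finmap boolp zify.

(** Colour the subgraph induced by [A] by induction on [#|A|]. A partial
    colouring can be extended to an uncoloured vertex [u] greedily: each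
    neighbour [w] of [u] forbids its own colour and, as long as only one or two
    colours occur around it, these colours too, so at most three colours in all.
    Hence [u] is reducible when its set [X] of neighbours of degree at most 2 is
    nonempty and [3 d(u) - 2 #|X| <= 7]: colour [A :\: X], uncolour [u], then
    colour [u] (each member of [X] now forbids at most one colour) and finally
    the members of [X] (at most six forbidden colours each). Vertices of degree
    at most 1 are reducible as well. If nothing is reducible, then
    [#|X| + 6 <= 2 d(u) + 2 [d(u) <= 2]] for each [u]; summing over [u] and
    counting the edges at 2-vertices on both sides gives average degree at
    least 3. *)

Set Implicit Arguments.
Unset Strict Implicit.
Unset Printing Implicit Defensive.

Import Order.TTheory GRing.Theory Num.Theory.

(** * Degree sums and the maximum average degree *)

Section DegreeSum.
Variable G : sgraph.
Implicit Type A : {set G}.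

Definition arcs (A : {set G}) : {set G * G} :=
  [set p | [&& p.1 \in A, p.2 \in A & adj p.1 p.2]].

Definition induced_edges (A : {set G}) : {set {set G}} :=
  [set e in edges G | e \subset A].

(** Count the ordered adjacent pairs in [A]: forgetting the order maps them two-to-one onto the
    induced edges. *)
Lemma degree_sum A :
  \sum_(v in A) #|nbh v :&: A| = 2 * #|induced_edges A|.
Proof.
have -> : \sum_(v in A) #|nbh v :&: A| = #|arcs A|.
  rewrite -sum1_card (eq_bigl (fun p : G * G => (p.1 \in A) &&
    ((p.2 \in A) && adj p.1 p.2))); last by move=> p; rewrite inE.
  rewrite -(pair_big_dep (mem A) (fun x y => (y \in A) && adj x y)
              (fun _ _ => 1)) /=.
  apply: eq_bigr => x _; rewrite -sum1_card; apply: eq_bigl => y.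
  by rewrite !inE andbC.
pose und (p : G * G) := [set p.1; p.2].
have -> : #|arcs A| =
    \sum_(e in induced_edges A) \sum_(p in arcs A | und p == e) 1.
  rewrite -sum1_card (partition_big und (mem (induced_edges A))) //= => p.
  rewrite inE => /and3P[p1A p2A p12]; rewrite inE.
  apply/andP; split; last by rewrite subUset !sub1set p1A.
  by apply/imset2P; exists p.1 p.2 => //; rewrite inE.
rewrite mulnC -sum_nat_const; apply: eq_bigr => e.
rewrite inE => /andP[/imset2P[x y _]]; rewrite inE => xy -> xyA.
have xNy : x != y by apply/eqP => exy; rewrite exy adj_irrefl in xy.
rewrite sum1dep_card -[RHS](_ : #|[set (x, y); (y, x)]| = 2); last first.
  by rewrite cards2 xpair_eqE negb_and xNy.
move: xyA; rewrite subUset !sub1set => /andP[xA yA].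
apply: eq_card => -[a b]; rewrite !inE !xpair_eqE /=; apply/idP/idP.
  case/andP=> /and3P[aA bA ab] /eqP eab.
  have aNb : a != b by apply/eqP => e'; rewrite e' adj_irrefl in ab.
  have : a \in [set x; y] by rewrite -eab set21.
  have : b \in [set x; y] by rewrite -eab set22.
  by rewrite !inE; case/orP=> /eqP eb /orP[] /eqP ea;
    rewrite ea eb eqxx in aNb *; rewrite ?eqxx ?orbT.
case/orP=> /andP[/eqP-> /eqP->]; rewrite xA yA ?xy ?(adj_sym y) ?xy //=.
by apply/eqP; rewrite /und setUC.
Qed.

(** The subgraph induced by [A] is one of the competitors in the maximum [mad G]. *)
Lemma mad_degree_sum A : (mad G < 3)%R -> A != set0 ->
  \sum_(v in A) #|nbh v :&: A| < 3 * #|A|.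
Proof.
move=> madG A0; rewrite degree_sum.
have A_gt0 : 0 < #|A| by rewrite card_gt0.
have sub : is_subgraph (A, induced_edges A).
  apply/andP; split; first by apply/subsetP => e; rewrite inE => /andP[].
  by apply/forall_inP => e; rewrite inE => /andP[].
have : (2 * #|induced_edges A|%:R / #|A|%:R <= mad G)%R.
  apply: (@le_bigmax_cond _ _ _ _ (A, induced_edges A) _
    (fun H : {set G} * {set {set G}} => 2 * #|H.2|%:R / #|H.1|%:R)%R).
  by rewrite sub.
move=> /le_lt_trans/(_ madG); rewrite ltr_pdivrMr ?ltr0n //.
by rewrite -!natrM ltr_nat.
Qed.

End DegreeSum.

(** * Partial colourings and their greedy extension *)

Section PartialColoring.
Variables (G : sgraph) (C : choiceType) (L : G -> {fset C}).
Hypothesis card_L : forall v, 8 <= #|` L v|.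
Implicit Types (A S B : {set G}) (phi : G -> C).

Definition colors phi (B : {set G}) : {fset C} := [fset phi u | u in B]%fset.

(* Only the vertices of [S] are regarded as coloured; the last clause says that
   the missing colours around [w] can still come from its uncoloured
   neighbours. *)
Definition partial_coloring A S phi : Prop :=
  [/\ forall v, phi v \in L v,
      {in S &, forall u v, adj u v -> phi u <> phi v} &
      {in A, forall w, minn 3 #|nbh w :&: A| <=
         #|` colors phi (nbh w :&: S)| + #|(nbh w :&: A) :\: S|}].

Lemma colorsP phi B c :
  reflect (exists2 u, u \in B & c = phi u) (c \in colors phi B).
Proof. exact: imfsetP. Qed.

Lemma card_colors_le phi B : #|` colors phi B| <= #|B|.
Proof. by rewrite cardE; exact: leq_imfset_card. Qed.

Lemma colorsU1 phi B u : colors phi (u |: B) = (phi u |` colors phi B)%fset.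
Proof.
apply/fsetP => c; rewrite !inE; apply/colorsP/orP.
  case=> v /setU1P[->|vB] ->; [by left|right].
  by apply/colorsP; exists v.
case=> [/eqP->|/colorsP[v vB ->]]; first by exists u; rewrite ?setU11.
by exists v; rewrite ?setU1r.
Qed.

Lemma card_colors_le1 phi B : #|B| <= 1 -> #|` colors phi B| = #|B|.
Proof.
move=> B1; case: (set_0Vmem B) => [->|[x xB]].
  apply/eqP; rewrite cards0 -leqn0 -(cards0 G); exact: card_colors_le.
have -> : B = x |: set0.
  apply/eqP; rewrite setU0 eq_sym eqEcard sub1set xB cards1.
  exact: B1.
apply/eqP; rewrite eqn_leq card_colors_le colorsU1 setU0 cards1 cardfs_gt0.
by apply/fset0Pn; exists (phi x); rewrite fset1U1.
Qed.

Lemma card_colors_diff phi B B' :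
  #|` colors phi B| <= #|` colors phi B'| + #|B :\: B'|.
Proof.
apply: (@leq_trans #|` (colors phi B' `|` colors phi (B :\: B'))%fset|).
  apply/fsubset_leq_card/fsubsetP => c /colorsP[u uB ->]; rewrite inE.
  have [uB'|uB'] := boolP (u \in B').
    by apply/orP; left; apply/colorsP; exists u.
  by apply/orP; right; apply/colorsP; exists u => //; rewrite inE uB'.
rewrite cardfsU; apply: leq_trans (leq_subr _ _) _.
by rewrite leq_add2l card_colors_le.
Qed.

Lemma eq_in_colors phi psi B : {in B, phi =1 psi} -> colors phi B = colors psi B.
Proof.
move=> e; apply/fsetP => c; apply/colorsP/colorsP => -[u uB ->];
  by exists u; rewrite ?e.
Qed.

(** This enlarges the ambient set from [S0] to [A] and uncolours [S0 :\: S]. Around a vertex of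
    [S0], each uncoloured neighbour costs at most one colour and adds one to the uncoloured count.
    Any other vertex of [A] has at most one coloured neighbour, so no colour repeats around it. *)
Lemma partial_coloring_sub A S S0 phi : S \subset S0 -> S0 \subset A ->
  partial_coloring S0 S0 phi ->
  (forall w, w \in A :\: S0 -> #|nbh w :&: S| <= 1) ->
  partial_coloring A S phi.
Proof.
move=> sSS0 sS0A [phiL phi_proper phi_dyn] small; split=> //.
  by move=> x y /(subsetP sSS0) xS /(subsetP sSS0) yS; exact: phi_proper.
move=> w wA.
have cardA : #|nbh w :&: A| = #|nbh w :&: S| + #|(nbh w :&: A) :\: S|.
  rewrite -(cardsID S); congr (#|pred_of_set _| + _).
  by rewrite -setIA (setIidPr (subset_trans sSS0 sS0A)).
have [wS0|wS0] := boolP (w \in S0); last first.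
  rewrite card_colors_le1 -?cardA ?geq_minr //.
  by apply: small; rewrite inE wS0.
have := phi_dyn w wS0.
have -> : (nbh w :&: S0) :\: S0 = set0.
  by apply/setP => x; rewrite !inE; case: (x \in S0); rewrite ?andbF.
rewrite cards0 addn0 => dyn0.
have diff := card_colors_diff phi (nbh w :&: S0) (nbh w :&: S).
have eD : (nbh w :&: S0) :\: (nbh w :&: S) = (nbh w :&: S0) :\: S.
  by apply/setP => x; rewrite !inE; case: (adj w x); rewrite /= ?andbF.
rewrite {}eD in diff.
have card0 : #|nbh w :&: S0| = #|nbh w :&: S| + #|(nbh w :&: S0) :\: S|.
  rewrite -(cardsID S); congr (#|pred_of_set _| + _).
  by rewrite -setIA (setIidPr sSS0).
have : #|(nbh w :&: S0) :\: S| <= #|(nbh w :&: A) :\: S|.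
  by rewrite subset_leq_card // setSD // setIS.
by move: dyn0 diff cardA card0; lia.
Qed.

Lemma avoid_fsets (I : finType) (B : {set I}) (F : I -> {fset C}) (K : {fset C}) :
  \sum_(i in B) #|` F i| < #|` K| ->
  exists2 c, c \in K & forall i, i \in B -> c \notin F i.
Proof.
move=> lt_FK; pose U := (\bigcup_(i in B) F i)%fset.
have cardU : #|` U| <= \sum_(i in B) #|` F i|.
  rewrite /U; elim/big_rec2: _ => [|i n V _ IH]; first by rewrite cardfs0.
  rewrite cardfsU; apply: leq_trans (leq_subr _ _) _.
  by rewrite leq_add2l.
have : ~~ (K `<=` U)%fset.
  apply/negP => /fsubset_leq_card; apply/negP; rewrite -ltnNge.
  exact: leq_ltn_trans lt_FK.
case/fsubsetPn => c cK cU; exists c => // i iB; apply: contra cU => cF.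
by apply/bigfcupP; exists i; rewrite // mem_index_enum.
Qed.

Lemma partial_coloring_extend A S u phi :
  S \subset A -> u \notin S -> partial_coloring A S phi ->
  \sum_(w in nbh u :&: A) ((w \in S) + minn 2 #|nbh w :&: S|) <= 7 ->
  exists psi, partial_coloring A (u |: S) psi.
Proof.
move=> sSA uNS [phiL phi_proper phi_dyn] few.
(* Once three colours occur around [w], a repeated colour at [u] does no harm there, so only the
   colour of [w] itself stays forbidden. *)
pose forb w := ((if w \in S then [fset phi w] else fset0) `|`
  (if #|` colors phi (nbh w :&: S)| <= 2 then colors phi (nbh w :&: S)
   else fset0))%fset.
have card_forb w : #|` forb w| <= (w \in S) + minn 2 #|nbh w :&: S|.
  rewrite /forb cardfsU; apply: leq_trans (leq_subr _ _) _.
  apply: leq_add; first by case: (w \in S); rewrite ?cardfs1 ?cardfs0.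
  case: ifP => [le2|_]; last by rewrite cardfs0.
  by rewrite leq_min le2 card_colors_le.
have [|c cL cNF] := @avoid_fsets _ (nbh u :&: A) forb (L u).
  apply: leq_trans (card_L u); rewrite ltnS; apply: leq_trans few.
  by apply: leq_sum => w _; exact: card_forb.
pose psi v := if v == u then c else phi v.
have psiS : {in S, psi =1 phi}.
  by move=> v vS; rewrite /psi; case: eqP => // e; rewrite -e vS in uNS.
have psiu : psi u = c by rewrite /psi eqxx.
have c_proper v : v \in S -> adj u v -> c <> phi v.
  move=> vS uv e; have := cNF v; rewrite !inE uv (subsetP sSA) //.
  by move=> /(_ isT); rewrite vS inE e eqxx.
exists psi; split.
- by move=> v; rewrite /psi; case: eqP => [->|].
- move=> x y /setU1P[->|xS] /setU1P[->|yS]; rewrite ?psiu ?psiS //.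
  + by rewrite adj_irrefl.
  + exact: c_proper.
  + by rewrite adj_sym => uy; apply/nesym/c_proper.
  + exact: phi_proper.
move=> w wA; have := phi_dyn w wA.
have colS : colors psi (nbh w :&: S) = colors phi (nbh w :&: S).
  by apply: eq_in_colors => v; rewrite inE => /andP[_ /psiS].
have [wu|wu] := boolP (adj w u); last first.
  have -> : nbh w :&: (u |: S) = nbh w :&: S.
    by apply/setP => x; rewrite !inE; case: eqP => //= ->; rewrite (negPf wu).
  rewrite colS.
  suff -> : (nbh w :&: A) :\: (u |: S) = (nbh w :&: A) :\: S by [].
  by apply/setP => x; rewrite !inE; case: eqP => //= ->;
    rewrite (negPf wu) /= andbF.
have -> : nbh w :&: (u |: S) = u |: (nbh w :&: S).
  by apply/setP => x; rewrite !inE; case: eqP => //= ->; rewrite wu.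
rewrite colorsU1 psiu colS cardfsU1.
have le_unc : #|(nbh w :&: A) :\: S| <= (#|(nbh w :&: A) :\: (u |: S)|).+1.
  rewrite -[X in X <= _](cardsID [set u]) addnC -addn1 leq_add //.
    by rewrite setDDl setUC.
  by rewrite -(cards1 u) subset_leq_card // subsetIr.
have := cNF w; rewrite inE inE adj_sym wu wA => /(_ isT).
rewrite /forb inE negb_or => /andP[_].
(* Either [c] is new around [w], which makes up for the loss of the uncoloured neighbour [u], or
   three colours are already present. *)
case: ifP => [_ ->|gt2 _]; first by move: le_unc; lia.
by move: gt2 le_unc; lia.
Qed.

Lemma partial_coloring_complete A S phi :
  S \subset A -> partial_coloring A S phi ->
  (forall v, v \in A :\: S -> #|nbh v :&: A| <= 2) ->
  exists psi, partial_coloring A A psi.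
Proof.
have [n] := ubnP #|A :\: S|; elim: n S phi => // n IHn S phi.
rewrite ltnS => leSn sSA colS small.
have [/eqP|[v vAS]] := set_0Vmem (A :\: S).
  rewrite setD_eq0 => sAS; exists phi.
  have eSA : S = A by apply/eqP; rewrite eqEsubset sSA.
  by rewrite eSA in colS.
have [vA vNS] := setDP vAS.
have [|psi colpsi] := partial_coloring_extend sSA vNS colS.
  apply: (@leq_trans (\sum_(w in nbh v :&: A) 3)).
    by apply: leq_sum => w _; case: (w \in S); rewrite ?leq_add ?geq_minl //=;
       apply: leq_trans (geq_minl _ _) _.
  by rewrite sum_nat_const; have := small v vAS; lia.
apply: IHn colpsi _; last first.
- by move=> w /setDP[wA]; rewrite inE negb_or => /andP[_ wNS];
    apply: small; rewrite inE wNS.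
- by rewrite subUset sub1set vA.
apply: leq_trans leSn; apply: proper_card.
rewrite properE setDS ?subsetUr //=; apply/subsetPn; exists v => //.
by rewrite !inE eqxx.
Qed.

(** * Reducible configurations and their unavoidability *)

Definition small_nbh A u := [set v in nbh u :&: A | #|nbh v :&: A| <= 2].

Lemma reducible_leaf A v : v \in A -> #|nbh v :&: A| <= 1 ->
  (exists phi, partial_coloring (A :\ v) (A :\ v) phi) ->
  exists phi, partial_coloring A A phi.
Proof.
move=> vA dv [phi colphi].
have only_v w : w \in A :\: (A :\ v) -> w = v.
  by rewrite !inE => /andP[/nandP[/negPn/eqP|/negPf->]].
apply: (@partial_coloring_complete A (A :\ v) phi).
- exact: subD1set.
- apply: partial_coloring_sub colphi _ => //; first exact: subD1set.
  move=> w /only_v->; apply: leq_trans dv.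
  by rewrite subset_leq_card // setIS // subD1set.
- by move=> w /only_v->; exact: leq_trans dv _.
Qed.

(** Although [u] is recoloured, it stays in the smaller graph: the colouring of [A :\: X] then meets
    the dynamic condition around [u], where several coloured neighbours may remain. *)
Lemma reducible_vertex A u (X := small_nbh A u) :
  u \in A -> 3 * #|nbh u :&: A| <= 7 + 2 * #|X| ->
  (exists phi, partial_coloring (A :\: X) (A :\: X) phi) ->
  exists phi, partial_coloring A A phi.
Proof.
move=> uA du [phi colphi].
have sXN : X \subset nbh u :&: A by apply/subsetP => v; rewrite inE => /andP[].
have uNX : u \notin X by rewrite !inE adj_irrefl.
pose S := (A :\: X) :\ u.
have sSA : S \subset A by apply/subsetP => v; rewrite !inE => /and3P[].
have uNS : u \notin S by rewrite !inE eqxx.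
have inX w : w \in A :\: (A :\: X) -> w \in X.
  by rewrite !inE => /andP[/nandP[/negPn|/negPf->]].
(* One of the at most two neighbours of [w] is [u], which is uncoloured in [S]. *)
have one w : w \in X -> #|nbh w :&: S| <= 1.
  rewrite inE inE => /andP[/andP[]]; rewrite inE adj_sym => wu wA dw.
  rewrite -ltnS; apply: leq_trans dw; apply: proper_card.
  rewrite properE setIS //=; apply/subsetPn; exists u; first by rewrite !inE wu.
  by rewrite !inE eqxx andbF.
have colS : partial_coloring A S phi.
  apply: partial_coloring_sub colphi _; rewrite ?subD1set ?subsetDl //.
  by move=> w /inX/one.
have [|psi colpsi] := partial_coloring_extend sSA uNS colS.
  rewrite (big_setID X) /= (setIidPr sXN).
  apply: (@leq_trans (\sum_(w in X) 1 +
                      \sum_(w in (nbh u :&: A) :\: X) 3)).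
    apply: leq_add; apply: leq_sum => w wX.
      have -> : (w \in S) = false by rewrite in_setD1 in_setD wX andbF.
      by apply: leq_trans (geq_minr _ _) (one w wX).
    by case: (w \in S); rewrite ?leq_add ?geq_minl //=;
       apply: leq_trans (geq_minl _ _) _.
  rewrite !sum_nat_const cardsD (setIidPr sXN).
  by have := subset_leq_card sXN; lia.
(* Only members of [X] are still uncoloured. *)
apply: partial_coloring_complete colpsi _.
  by rewrite subUset sub1set uA.
move=> v /setDP[vA]; rewrite !inE vA.
by case: eqP => //= _; case: (adj u v) => //=; case: leqP.
Qed.

Lemma unavoidable A : A != set0 ->
  \sum_(v in A) #|nbh v :&: A| < 3 * #|A| ->
  exists2 u, u \in A & #|nbh u :&: A| <= 1 \/
    small_nbh A u != set0 /\ 3 * #|nbh u :&: A| <= 7 + 2 * #|small_nbh A u|.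
Proof.
move=> A0 sparse.
have [/existsP[u /and3P[uA X0 du]]|no_red] := boolP [exists u,
    [&& u \in A, small_nbh A u != set0 &
        3 * #|nbh u :&: A| <= 7 + 2 * #|small_nbh A u|]].
  by exists u => //; right.
have [/existsP[u /andP[uA du]]|no_leaf] := boolP [exists u,
    (u \in A) && (#|nbh u :&: A| <= 1)].
  by exists u => //; left.
exfalso; move: sparse; apply/negP; rewrite -leqNgt.
pose d v := #|nbh v :&: A|.
(* If [small_nbh A u] is empty, [d u >= 2] suffices. Otherwise irreducibility forces [d u >= 4] and
   allows at most 2 or 3 such neighbours when [d u] is 4 or 5; from 6 on, the trivial bound [d u] is
   enough. *)
have local u : u \in A -> #|small_nbh A u| + 6 <= 2 * d u + 2 * (d u <= 2).
  move=> uA; move: no_red no_leaf.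
  rewrite !negb_exists => /forallP/(_ u); rewrite uA /= -card_gt0 => red.
  move=> /forallP/(_ u); rewrite uA /= => leaf.
  have : #|small_nbh A u| <= d u.
    by apply: subset_leq_card; apply/subsetP => v; rewrite inE => /andP[].
  by move: red leaf; rewrite /d; lia.
have count : \sum_(u in A) #|small_nbh A u| = \sum_(u in A) 2 * (d u <= 2).
  under eq_bigr do rewrite -sum1_card.
  rewrite (exchange_big_dep (mem A)) /=; last first.
    by move=> u v uA; rewrite !inE => /andP[/andP[]].
  apply: eq_bigr => v vA; rewrite sum1dep_card.
  have [dv|dv] := leqP (d v) 2; last first.
    apply: eq_card0 => u; rewrite !inE leqNgt; move: dv.
    by rewrite /d => ->; rewrite !andbF.
  (* Without leaves, degree at most 2 means exactly 2. *)
  have -> : 2 * true = d v.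
    move: no_leaf; rewrite negb_exists => /forallP/(_ v).
    by rewrite vA /= -ltnNge; move: dv; rewrite /d; lia.
  apply: eq_card => u; rewrite !inE vA adj_sym -/(d v) dv !andbT.
  by rewrite andbC.
have : \sum_(u in A) (#|small_nbh A u| + 6) <=
       \sum_(u in A) (2 * d u + 2 * (d u <= 2)) by exact: leq_sum.
(* The two sums in [count] cancel, leaving six times [#|A|] at most twice the degree sum. *)
by rewrite 2!big_split /= count sum_nat_const -!big_distrr /= /d; lia.
Qed.

(** Sparsity is assumed for every nonempty vertex set, so it is available at each smaller set of the
    induction. *)
Lemma complete_coloring A :
  (forall B, B != set0 -> \sum_(v in B) #|nbh v :&: B| < 3 * #|B|) ->
  exists phi, partial_coloring A A phi.
Proof.
move=> sparse; have [n] := ubnP #|A|; elim: n A => // n IHn A.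
rewrite ltnS => leAn.
have [->|A0] := eqVneq A set0.
  (* A partial colouring is a total function into the lists, so even with nothing coloured each list
     must supply a value. *)
  have nonempty v : exists c, c \in L v.
    by apply/fset0Pn; rewrite -cardfs_gt0; exact: leq_trans (card_L v).
  exists (fun v => xchoose (nonempty v)).
  by split=> [v|u v|w]; rewrite ?inE //; exact: xchooseP.
have [u uA [leaf|[X0 du]]] := unavoidable A0 (sparse A A0).
  apply: (reducible_leaf uA leaf (IHn _ _)).
  by rewrite (cardsD1 u) uA in leAn.
apply: (reducible_vertex uA du (IHn _ _)).
apply: leq_trans leAn; apply: proper_card; rewrite properE subsetDl /=.
case/set0Pn: X0 => v vX; apply/subsetPn; exists v.
  by move: vX; rewrite !inE => /andP[/andP[]].
by rewrite inE vX.
Qed.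

End PartialColoring.

Theorem theorem1p5 (G : sgraph) :
  (mad G < 3)%R -> list_dynamic_chromatic_number G 3 <= 8.
Proof.
move=> madG; rewrite /list_dynamic_chromatic_number.
case: ex_minnP => m _; apply; apply/asboolP => C L cardL.
have [phi [phiL phi_proper phi_dyn]] :=
  complete_coloring cardL [set: G] (fun B => @mad_degree_sum G B madG).
exists phi; split=> //; split=> [u v|v]; first exact: phi_proper.
(* With every vertex coloured, the uncoloured term vanishes and the dynamic condition remains. *)
have := phi_dyn v (in_setT v).
by rewrite setDT cards0 addn0 setIT.
Qed.
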